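(* (1) For any BP-measurable linearly continuous function $f:X\to Y$ from a Baire cosmic vector space $X$ to a separable metrizable space $Y$, the set $D(f)$ of discontinuity points of $f$ is $\bar\sigma$-$\ell$-miserable in $X$. (2) For any $\bar\sigma$-$\ell$-miserable set $M$ in a metrizable topological vector space $X$, there exists a lower semicontinuous (and hence $F_\sigma$-measurable) linearly continuous function $f:X\to[0,1]$ such that $D(f)=M$, where $D(f)$ is the set of discontinuity points of $f$.
   Context: All topological vector spaces are over $\mathbb R$ and are assumed to be Hausdorff. A cosmic vector space is a topological vector space which is a continuous image of a separable metrizable space; a Baire cosmic vector space is a cosmic vector space that is a Baire space as a topological space. A function $f:X\to Y$ from a topological vector space $X$ to a topological space $Y$ is linearly continuous if for any $x,v\in X$ the function $\mathbb R\to Y$, $t\mapsto f(x+tv)$, is continuous. A subset $U$ of a topological space $Y$ is functionally open if $U=g^{-1}(V)$ for some continuous $g:Y\to\mathbb R$ and some open $V\subseteq\mathbb R$. A subset $A$ of a topological space $X$ has the Baire property in $X$ if there is an open set $U\subset X$ such that $U\triangle A$ is meager in $X$. A function $f:X\to Y$ is BP-measurable (resp. $F_\sigma$-measurable) if for every functionally open $U\subset Y$ the preimage $f^{-1}(U)$ has the Baire property in $X$ (resp. is a countable union of closed sets of $X$). A function $f:X\to\mathbb R$ is lower semicontinuous if for every $a\in\mathbb R$ the set $\{x\in X:f(x)>a\}$ is open in $X$. A subset $V$ of a topological vector space $X$ is an $\ell$-neighborhood of a set $A\subset X$ if for any $a\in A$ and $v\in X$ there exists $\varepsilon>0$ such that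 $a+[0,\varepsilon)\cdot v\subset V$. A subset $A$ of $X$ is $\ell$-miserable if $A\subset\overline{X\setminus L}$ for some closed $\ell$-neighborhood $L$ of $A$ in $X$; it is $\bar\sigma$-$\ell$-miserable if $A$ is a countable union of closed $\ell$-miserable sets in $X$. *)

(* Defs.v *)
From HB Require Import structures.
From mathcomp Require Import all_boot all_order all_algebra.
From mathcomp Require Import all_classical all_reals all_analysis borel_hierarchy.

Set Implicit Arguments.
Unset Strict Implicit.
Unset Printing Implicit Defensive.

Import Order.TTheory GRing.Theory Num.Theory.
Import numFieldNormedType.Exports.

Local Open Scope classical_set_scope.
Local Open Scope ring_scope.

Section topological_spaces.
Context {T : topologicalType}.

Definition separable_space := exists2 S : set T, countable S & dense S.

Definition nowhere_dense (A : set T) := interior (closure A) = set0.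

Definition meager (A : set T) :=
  exists2 F : (set T)^nat, (forall n, nowhere_dense (F n)) & A = \bigcup_n F n.

Definition baire_space := forall F : (set T)^nat,
  (forall n, open (F n) /\ dense (F n)) -> dense (\bigcap_n F n).

Definition Baire_property (A : set T) :=
  exists2 U : set T, open U & meager ((U `\` A) `|` (A `\` U)).

End topological_spaces.
Arguments separable_space : clear implicits.
Arguments baire_space : clear implicits.

Section real_dependent_notions.
Variable R : realType.

Definition metrizable (T : topologicalType) :=
  exists d : T -> T -> R,
    [/\ forall x, d x x = 0,
        forall x y, d x y = 0 -> x = y,
        forall x y, d x y = d y x,
        forall y x z, d x z <= d x y + d y z &
        forall x, nbhs x = nbhs_ball_ (fun p e => [set q | d p q < e]) x].

Definition cosmic (T : topologicalType) :=
  exists S : topologicalType, [/\ metrizable S, separable_space S &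
    exists2 g : S -> T, continuous g & range g = [set: T]].

Definition functionally_open (Y : topologicalType) (U : set Y) :=
  exists2 g : Y -> R, continuous g &
    exists2 V : set R, open V & U = g @^-1` V.

Definition BP_measurable (X Y : topologicalType) (f : X -> Y) :=
  forall U : set Y, functionally_open U -> Baire_property (f @^-1` U).

Definition Fsigma_measurable (X Y : topologicalType) (f : X -> Y) :=
  forall U : set Y, functionally_open U -> Fsigma (f @^-1` U).

Definition real_lower_semicontinuous (X : topologicalType) (f : X -> R) :=
  forall a : R, open [set x | a < f x].

Lemma real_lower_semicontinuousE (X : topologicalType) (f : X -> R) :
  real_lower_semicontinuous f <-> lower_semicontinuous (EFin \o f).
Proof. by split=> [?|/lower_semicontinuousP//]; apply/lower_semicontinuousP. Qed.

End real_dependent_notions.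

Definition discontinuity_set (X Y : topologicalType) (f : X -> Y) : set X :=
  [set x | ~ {for x, continuous f}].

Section topological_vector_spaces.
(* [tvsType] would also impose local convexity, and [topologicalLmodType] does
   not include the Hausdorff axiom. *)
Context {R : realType} {X : topologicalLmodType R}.

Definition linearly_continuous (Y : topologicalType) (f : X -> Y) :=
  forall x v : X, continuous (fun t : R => f (x + t *: v)).

Definition l_neighborhood (V A : set X) :=
  forall a v : X, A a ->
    exists2 e : R, 0 < e & forall t : R, 0 <= t < e -> V (a + t *: v).

Definition l_miserable (A : set X) :=
  exists L : set X, [/\ closed L, l_neighborhood L A & A `<=` closure (~` L)].

Definition sigma_l_miserable (A : set X) :=
  exists2 F : (set X)^nat,
    (forall n, closed (F n) /\ l_miserable (F n)) & A = \bigcup_n F n.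

End topological_vector_spaces.

(* Main.v *)
Require Import Defs.
From HB Require Import structures.
From mathcomp Require Import all_boot all_order all_algebra.
From mathcomp Require Import all_classical all_reals all_analysis.
From mathcomp Require Import lra.

Import Order.TTheory GRing.Theory Num.Theory.
Import numFieldNormedType.Exports.

Local Open Scope classical_set_scope.
Local Open Scope ring_scope.

(** Necessity.  Let [V] and [W] be disjoint sets with the Baire property, each an
l-neighborhood of itself, so equal to open sets [H] and [G] up to meager sets.
If [a] is in [V], every vector [v] satisfies [a + v / n] in [V] for large [n],
so a neighborhood of [a] in which [V] is meager would make the whole space a
countable union of homothetic copies of a meager set
([quasi_open_meets]).  Hence [V] lies in the closure of [H], and as the open set
[G `&` H] is meager it is empty: [G] misses the closure of [V]
([separating_quasi_open]).  Two consequences are used.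
- Every point of [W] is a limit of points outside [closure V]
  ([sub_closure_setC_closure]).
- If [closure V] contains a cone [x + t *: v] ([t] in [(0, e)], [v] in a
  nonempty open set [O]), then [x] is not in [W] ([cone_in_closure_notin]).
Being the apex of such a cone, for fixed [O] and [e], is a closed condition on
[x]; and when [f x] lies in an open set [U], the point [x] is the apex of a cone
in the closure of [f @^-1` U], with [O] taken from a countable list provided by
the countable network of the space ([linearly_continuous_cone]).  For a ball
[B(y, r)] of [Y] let [F] be the set of apices of such cones for [B(y, r)]
that are limits of points where [d y (f z) >= 3 r].  Then [F] is closed,
[d y (f x) <= r] for each [x] in [F], and
[L = closure (f @^-1` B(y, 2 r))] witnesses that [F] is l-miserable: points with
[d y (f z) >= 3 r] are limits of points outside [L].  Countably many such [F]
cover the discontinuities of [f], and [f] is discontinuous on each of them.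

Sufficiency.  Given a closed [F] with closed l-neighborhood [L] such that [F]
lies in the closure of [~` L], choose a set [D] outside [L] which accumulates
exactly at [F] ([separated_subset]) and take
[g = dist L / (dist L + dist D)] off [F], [g = 0] on [F].  Off [F] this is
continuous; it is 1 on [D], so discontinuous on [F]; and it vanishes on [L],
hence near each point of [F] along every line ([l_miserable_bump]).  For
countably many sets [F n] the functions are added with weights [2 ^ -(n + 1)];
lower semicontinuity prevents the discontinuities of the summands from
cancelling ([halving_sum_discontinuous]). *)

(** * Meager sets in Baire spaces *)

Lemma sub_meager {T : topologicalType} (A B : set T) :
  A `<=` B -> meager B -> meager A.
Proof.
move=> AB [F ndF BF]; exists (fun n => F n `&` A).
  move=> n; apply/seteqP; split=> //; rewrite -[X in _ `<=` X](ndF n).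
  by apply: interiorS; apply: closure_subset; exact: subIsetl.
by rewrite -setI_bigcupl -BF; apply/esym/setIidPr.
Qed.

Lemma bigcup_meager {T : topologicalType} (F : (set T)^nat) :
  (forall n, meager (F n)) -> meager (\bigcup_n F n).
Proof.
move=> mF.
have /choice[G GP] : forall n, exists G : (set T)^nat,
    (forall k, nowhere_dense (G k)) /\ F n = \bigcup_k G k.
  by move=> n; have [G ndG FG] := mF n; exists G.
exists (fun m => if unpickle m is Some (n, k) then G n k else set0).
  move=> m; case: unpickle => [[n k]|]; first exact: (GP n).1.
  by rewrite /nowhere_dense closure0 interior0.
apply/seteqP; split=> [x [n _]|x [m _]].
  rewrite (GP n).2 => -[k _ Gx]; exists (pickle (n, k)) => //.
  by rewrite pickleK.
case: unpickle => // -[n k] Gx; exists n => //; rewrite (GP n).2.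
by exists k.
Qed.

Lemma setU_meager {T : topologicalType} (A B : set T) :
  meager A -> meager B -> meager (A `|` B).
Proof.
move=> mA mB; rewrite -bigcup2E; apply: bigcup_meager => -[|[|n]] //=.
by exists (fun=> set0); rewrite ?bigcup0// => _;
  rewrite /nowhere_dense closure0 interior0.
Qed.

Lemma baire_open_meager {T : topologicalType} (U : set T) :
  baire_space T -> open U -> meager U -> U = set0.
Proof.
move=> bT oU [F ndF UF]; apply: contrapT => /eqP/set0P U0.
have od n : open (~` closure (F n)) /\ dense (~` closure (F n)).
  split; first exact/closed_openC/closed_closure.
  move=> V [v Vv] oV; apply: contrapT => nV.
  have : interior (closure (F n)) v.
    rewrite /interior nbhsE; exists V; first by split.
    move=> w Vw; apply: contrapT => nw; apply: nV; by exists w.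
  by rewrite ndF.
have [x [Ux Fx]] := bT _ od U U0 oU.
by move: Ux; rewrite UF => -[n _ /subset_closure]; exact: Fx.
Qed.

(** The map [h] is a homeomorphism, given together with its inverse [k]. *)
Lemma preimage_meager {S T : topologicalType} (h : S -> T) (k : T -> S)
    (A : set T) :
  continuous h -> continuous k -> cancel h k -> cancel k h ->
  meager A -> meager (h @^-1` A).
Proof.
move=> ch ck hK kK [F ndF ->]; exists (fun n => h @^-1` F n); last first.
  by rewrite preimage_bigcup.
move=> n; apply/seteqP; split=> // x ix.
have : interior (closure (F n)) (h x).
  rewrite /interior nbhsE; exists (k @^-1` interior (closure (h @^-1` F n))).
    split; last by rewrite /= hK.
    by apply: open_comp => //; exact: open_interior.
  move=> y /= /interior_subset ky B; rewrite -{1}(kK y) => /ch/ky[z [Fz Bz]].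
  by exists (h z).
by rewrite ndF.
Qed.

(** * Countable families *)

(** Properties closed under the empty set can be transported from families
indexed by a countable type to sequences: codes of no index get [set0]. *)
Lemma bigcup_countType {T : Type} {I : countType} (P : set T -> Prop)
    (F : I -> set T) : P set0 -> (forall i, P (F i)) ->
  exists2 G : (set T)^nat, (forall n, P (G n)) & \bigcup_i F i = \bigcup_n G n.
Proof.
move=> P0 PF; exists (fun n => if unpickle n is Some i then F i else set0).
  by move=> n; case: unpickle.
apply/seteqP; split=> [x [i _ Fx]|x [n _]].
  by exists (pickle i) => //; rewrite pickleK.
by case: unpickle => // i Fx; exists i.
Qed.

Lemma countable_enum {T : Type} (A : set T) (x : T) :
  countable A -> exists e : nat -> T, A `<=` range e.
Proof.
move=> /countable_injP[f finj].
have /choice[e eP] : forall n, exists y, forall a, A a -> f a = n -> y = a.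
  move=> n; have [[a [Aa <-]]|na] := pselect (exists a, A a /\ f a = n).
    by exists a => b Ab /finj-> //; rewrite inE.
  by exists x => a Aa fan; exfalso; apply: na; exists a.
by exists e => a Aa; exists (f a) => //; exact: eP.
Qed.

Lemma natSinv_lt {R : realType} (e : R) : 0 < e -> exists n, n.+1%:R^-1 < e.
Proof.
move=> e0; have [n _ nP] := near_infty_natSinv_lt (PosNum e0).
by exists n; apply: (nP n) => /=.
Qed.

Lemma closure_sub_closed {T : topologicalType} (A B : set T) :
  closed B -> A `<=` B -> closure A `<=` B.
Proof. by move=> /closure_id clB AB; rewrite clB; exact: closure_subset. Qed.

(** * Spaces with a compatible metric *)

Lemma functionally_open_open {R : realType} {T : topologicalType} (U : set T) :
  functionally_open R U -> open U.
Proof. by move=> [g cg [V oV ->]]; apply: open_comp => // x _; exact: cg. Qed.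

Section metric.
Context {R : realType} {T : topologicalType} {d : T -> T -> R}.
Hypothesis dxx : forall x, d x x = 0.
Hypothesis d0 : forall x y, d x y = 0 -> x = y.
Hypothesis dC : forall x y, d x y = d y x.
Hypothesis dT : forall y x z, d x z <= d x y + d y z.
Hypothesis dN : forall x, nbhs x = nbhs_ball_ (fun p e => [set q | d p q < e]) x.

Lemma metric_ge0 x y : 0 <= d x y.
Proof. by have := dT y x x; rewrite dxx (dC y x); lra. Qed.

Lemma nbhs_metric_ball x e : 0 < e -> nbhs x [set y | d x y < e].
Proof. by move=> e0; rewrite dN; exists e. Qed.

Lemma metric_continuous x : continuous (d x).
Proof.
move=> y; apply/cvgrPdist_lt => e e0.
apply: filterS (nbhs_metric_ball y e e0) => z /= yz.
rewrite ltr_norml; have := dT y x z; have := dT z x y; rewrite (dC z y); lra.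
Qed.

Lemma metric_lt_functionally_open x r : functionally_open R [set y | d x y < r].
Proof.
exists (d x); first exact: metric_continuous.
by exists [set t | t < r]; first exact: open_lt.
Qed.

Lemma metric_gt_functionally_open x r : functionally_open R [set y | r < d x y].
Proof.
exists (d x); first exact: metric_continuous.
by exists [set t | r < t]; first exact: open_gt.
Qed.

Lemma dense_seq_close (e : nat -> T) (S : set T) (x : T) (r : R) :
  dense S -> S `<=` range e -> 0 < r -> exists n, d (e n) x < r.
Proof.
move=> dS Se r0.
have := nbhs_metric_ball x r r0; rewrite nbhsE => -[B [oB Bx] Br].
have [s [Bs Ss]] : B `&` S !=set0 by apply: dS => //; exists x.
by have [n _ ens] := Se s Ss; exists n; rewrite ens dC; exact: Br.
Qed.

Definition distance_to (A : set T) (x : T) : R := inf [set d x a | a in A].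

Lemma distance_to_le A x a : A a -> distance_to A x <= d x a.
Proof.
move=> Aa; apply: ge_inf; last by exists a.
by exists 0 => _ [b _ <-]; exact: metric_ge0.
Qed.

Lemma distance_to_ge0 A x : 0 <= distance_to A x.
Proof.
have [->|/set0P[a Aa]] := eqVneq A set0.
  by rewrite /distance_to image_set0 inf0.
apply: lb_le_inf; first by exists (d x a), a.
by move=> _ [b _ <-]; exact: metric_ge0.
Qed.

Lemma distance_to_mem A x : A x -> distance_to A x = 0.
Proof.
move=> Ax; apply/le_anti; rewrite distance_to_ge0 andbT -(dxx x).
exact: distance_to_le.
Qed.

Lemma distance_to_lt A x r : A !=set0 -> distance_to A x < r ->
  exists2 a, A a & d x a < r.
Proof.
move=> [a Aa] Axr; have r0 : 0 < r - distance_to A x by rewrite subr_gt0.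
have [|_ [b Ab <-] br] := inf_adherent r0 (E := [set d x a | a in A]).
  split; first by exists (d x a), a.
  by exists 0 => _ [b _ <-]; exact: metric_ge0.
by exists b => //; rewrite /distance_to addrC subrK in br.
Qed.

Lemma distance_to_lip A x y : A !=set0 ->
  distance_to A x <= d x y + distance_to A y.
Proof.
move=> A0; rewrite leNgt; apply/negP; rewrite addrC -ltrBrDr => lt.
have [a Aa ya] := distance_to_lt _ _ _ A0 lt.
have := distance_to_le _ x _ Aa; have := dT y x a; lra.
Qed.

Lemma distance_to_continuous A : A !=set0 -> continuous (distance_to A).
Proof.
move=> A0 x; apply/cvgrPdist_lt => e e0.
apply: filterS (nbhs_metric_ball x e e0) => y /= xy.
rewrite ltr_norml; have := distance_to_lip A x y A0.
have := distance_to_lip A y x A0; rewrite (dC y x); lra.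
Qed.

Lemma distance_to_gt0 A x : A !=set0 -> ~ closure A x -> 0 < distance_to A x.
Proof.
move=> A0 nclA; rewrite lt_neqAle distance_to_ge0 andbT eq_sym.
apply/negP => /eqP Ax0; apply: nclA => B; rewrite dN => -[r /= r0 rB].
have [|a Aa xa] := distance_to_lt A x r A0; first by rewrite Ax0.
by exists a; split=> //; exact: rB.
Qed.

(** [D] is a maximal subset of [U] in which distinct points are at distance at
least the smaller of their distances to [F].  Off [F] this distance to [F] is
locally bounded below, so [D] is closed and discrete there; near a point of [F]
it is small, so maximality forces points of [D] nearby. *)
Lemma separated_subset (F U : set T) : closed F -> F `<=` closure U ->
  exists D : set T, [/\ D `<=` U, F `<=` closure D & closure D `<=` D `|` F].
Proof.
move=> cF FU.
have [->|/set0P F0] := eqVneq F set0.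
  by exists set0; split=> //; rewrite closure0.
pose sep D := forall p q, D p -> D q ->
  d p q < distance_to F p -> d p q < distance_to F q -> p = q.
have [|D [[DU sepD] maxD]] := @Zorn_bigcup T [set D | D `<=` U /\ sep D].
  move=> C CP totC; split; first by move=> x [A /CP[AU _]]; exact: AU.
  move=> p q [A CA Ap] [B CB Bq].
  have [AB|BA] := totC A B CA CB.
    by apply: (CP B CB).2 => //; exact: AB.
  by apply: (CP A CA).2 => //; exact: BA.
exists D; split=> //.
  move=> a Fa B; rewrite dN => -[r /= r0 rB]; apply: contrapT => nDB.
  have far q : D q -> r <= d a q.
    move=> Dq; rewrite leNgt; apply/negP => aq; apply: nDB.
    by exists q; split => //; exact: rB.
  have r20 : 0 < r / 2 by lra.
  have [x [Ux /= ax]] := FU a Fa _ (nbhs_metric_ball a _ r20).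
  have Fx : distance_to F x <= d a x by rewrite dC; exact: distance_to_le.
  have Dx : ~ D x by move=> /far; lra.
  (* adding [x] to [D] keeps it separated: [distance_to F x] is below [r / 2] *)
  have xfar q : D q -> d x q < distance_to F x -> False.
    by move=> /far; have := dT x a q; lra.
  apply: (maxD (x |` D)).
    by split; [move=> y Dy; right|move=> /(_ x (or_introl erefl))].
  split; first by move=> y [->|/DU].
  move=> p q [->|Dp] [->|Dq] //.
  - by move=> /xfar-/(_ Dq).
  - by move=> _; rewrite dC => /xfar-/(_ Dp).
  - exact: sepD.
move=> x Dx; have [Fx|nFx] := pselect (F x); [by right|left].
have Fx0 : 0 < distance_to F x.
  by apply: distance_to_gt0 => //; move/closure_id : cF => <-.
have r0 : 0 < distance_to F x / 4 by lra.
have [p [Dp /= xp]] := Dx _ (nbhs_metric_ball x _ r0).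
have [<- //|/eqP px] := pselect (p = x).
have xp0 : 0 < d x p.
  rewrite lt_neqAle metric_ge0 andbT eq_sym; apply: contra_neq px => xp0.
  by apply/esym/d0.
have [q [Dq /= xq]] := Dx _ (nbhs_metric_ball x _ xp0).
suff pq : p = q by rewrite pq ltxx in xq.
have := dT x p q; rewrite (dC p x).
have := distance_to_lip F x p F0; have := distance_to_lip F x q F0.
by move=> *; apply: sepD => //; lra.
Qed.

(** Off [F], the closed sets [L] and [D] are disjoint and [g] separates them;
the values 1 taken on [D] accumulate at every point of [F]. *)
Lemma discontinuous_bump (F L : set T) :
  closed F -> closed L -> F `<=` L -> F `<=` closure (~` L) ->
  exists g : T -> R, [/\ forall x, 0 <= g x <= 1,
    forall x, ~ F x -> {for x, continuous g},
    forall x, L x -> g x = 0 &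
    F `<=` closure [set x | g x = 1]].
Proof.
move=> cF cL FL FcL.
have [->|/set0P[a Fa]] := eqVneq F set0.
  exists (fun=> 0); split=> //.
  - by move=> x; rewrite lexx ler01.
  - by move=> x _; exact: cst_continuous.
have [D [DL FD DF]] := separated_subset F (~` L) cF FcL.
have L0 : L !=set0 by exists a; exact: FL.
have D0 : D !=set0 by have [b [Db _]] := FD a Fa setT filterT; exists b.
pose q x := distance_to L x / (distance_to L x + distance_to D x).
have q_gt0 x : ~ F x -> 0 < distance_to L x + distance_to D x.
  move=> nFx; have [Lx|nLx] := pselect (L x).
    apply: ltr_wpDl; first exact: distance_to_ge0.
    by apply: distance_to_gt0 => // /DF[/DL|].
  apply: ltr_wpDr; first exact: distance_to_ge0.
  by apply: distance_to_gt0 => //; move/closure_id : cL => <-.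
exists (fun x => if x \in F then 0 else q x); split.
- move=> x; case: ifPn => [_|]; first by rewrite lexx ler01.
  rewrite notin_setE => /q_gt0 x0.
  rewrite divr_ge0 ?distance_to_ge0 ?(ltW x0)//= ler_pdivrMr// mul1r lerDl.
  exact: distance_to_ge0.
- move=> x nFx.
  have xF : \forall y \near x, ~ F y.
    by apply: open_nbhs_nbhs; split=> //; exact: closed_openC.
  rewrite /prop_for /continuous_at memNset//.
  apply: (@cvg_trans _ (q @ x)).
    apply: near_eq_cvg; apply: filterS xF => y nFy.
    by rewrite memNset.
  apply: cvgM; first exact: distance_to_continuous.
  apply: cvgV; first exact/lt0r_neq0/q_gt0.
  by apply: cvgD; exact: distance_to_continuous.
- by move=> x Lx; case: ifPn => // _; rewrite /q distance_to_mem// mul0r.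
- apply: subset_trans FD _; apply: closure_subset => x Dx /=.
  have nFx : ~ F x by move=> /FL; exact: DL.
  rewrite memNset// /q (distance_to_mem D)// addr0 divff//.
  by have := q_gt0 x nFx; rewrite (distance_to_mem D)// addr0 => /lt0r_neq0.
Qed.

(** The preimage of an open [U] is the union of the sets [p < f <= q], over
rational half-open intervals inside [U]; [f <= q] is closed, and the open set
[p < f] is the union of the closed sets [A p n] of points at distance at least
[1 / (n + 1)] from its complement. *)
Lemma lower_semicontinuous_Fsigma_measurable (f : T -> R) :
  real_lower_semicontinuous f -> Fsigma_measurable R f.
Proof.
move=> lf U /functionally_open_open oU.
pose A (p : rat) n := [set x | forall y, f y <= ratr p -> n.+1%:R^-1 <= d x y].
pose C (i : rat * rat * nat) := let: (p, q, n) := i in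
  if `[< `]ratr p, ratr q] `<=` U >] then A p n `&` [set x | f x <= ratr q]
  else set0.
have [||G cG CG] := @bigcup_countType T _ closed C.
- exact: closed0.
- move=> [[p q] n]; rewrite /C; case: asboolP => _; last exact: closed0.
  apply: closedI.
    move=> x clx y fy; rewrite leNgt; apply/negP => xy.
    have xy0 : 0 < n.+1%:R^-1 - d x y by rewrite subr_gt0.
    have [z [/(_ y fy) + /=]] := clx _ (nbhs_metric_ball x _ xy0).
    have := dT x z y; rewrite (dC z x); move: (_^-1) => c; lra.
  rewrite -openC; congr open: (lf (ratr q)).
  by apply/seteqP; split=> x /=; rewrite ltNge => /negP.
exists G => //; rewrite -CG; apply/seteqP; split=> [x Ux|x [[[p q] n] _]].
  have [e /= e0 eU] : nbhs (f x) U by exact: open_nbhs_nbhs.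
  have [p] : exists p, ratr p \in `]f x - e, f x[ by apply: rat_in_itvoo; lra.
  rewrite in_itv /= => /andP[p1 p2].
  have [q] : exists q, ratr q \in `]f x, f x + e[ by apply: rat_in_itvoo; lra.
  rewrite in_itv /= => /andP[q1 q2].
  have : nbhs x [set y | ratr p < f y].
    by apply: open_nbhs_nbhs; split => //; exact: lf.
  rewrite dN => -[r /= r0 rp]; have [n nr] := natSinv_lt _ r0.
  exists (p, q, n) => //=; rewrite asboolT.
    split; last exact: ltW.
    move=> y fy; rewrite leNgt; apply/negP => xy.
    by have := rp y (lt_trans xy nr); rewrite /= ltNge fy.
  move=> z /=; rewrite in_itv /= => /andP[pz zq]; apply: eU.
  by rewrite /ball /= ltr_norml; lra.
rewrite /C; case: asboolP => // pqU [Apx fxq]; apply: pqU => /=.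
rewrite in_itv /= fxq andbT ltNge; apply/negP => /Apx.
by rewrite dxx leNgt invr_gt0 ltr0n.
Qed.

End metric.

(** The images of the balls of radius [1 / (m + 1)] around a dense sequence of
the separable metrizable space that maps onto [X]. *)
Lemma cosmic_countable_network {R : realType} {X : topologicalType} (x0 : X) :
  cosmic R X -> exists N : nat * nat -> set X,
  forall U x, open U -> U x -> exists j, N j x /\ N j `<=` U.
Proof.
move=> [S [[d [dxx _ dC dT dN]] [D cD dD] [g cg gT]]].
have [s0 _ _] : range g x0 by rewrite gT.
have [e De] := countable_enum D s0 cD.
exists (fun j => g @` [set s | d (e j.1) s < j.2.+1%:R^-1]) => U x oU Ux.
have [s _ gsx] : range g x by rewrite gT.
have : nbhs s (g @^-1` U).
  by apply: cg; rewrite gsx; exact: open_nbhs_nbhs.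
rewrite dN => -[r /= r0 rU].
have r20 : 0 < r / 2 by rewrite divr_gt0.
have [m mr] := natSinv_lt _ r20.
have m0 : 0 < m.+1%:R^-1 :> R by rewrite invr_gt0 ltr0n.
have [n ens] := dense_seq_close dC dN e D s _ dD De m0.
exists (n, m); split=> /=; first by exists s.
move=> _ [t /= et <-]; apply: rU => /=.
have := dT (e n) s t; rewrite (dC s (e n)); by move: (_^-1) mr et ens => ?; lra.
Qed.

(** * Radial category arguments in a Baire topological vector space *)

Section topological_module.
Context {R : realType} {X : topologicalLmodType R}.

Lemma translate_scale_continuous (x : X) :
  continuous (fun z : R * X => x + z.1 *: z.2).
Proof.
move=> z; apply: (@continuous_comp (R * X)%type (X * X)%type X
   (fun z => (x, z.1 *: z.2)) (fun z => z.1 + z.2)); last exact: add_continuous.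
by apply: (@cvg_pair _ _ _ _ (nbhs x)); [exact: cvg_cst|exact: scale_continuous].
Qed.

Lemma line_continuous (x v : X) : continuous (fun t : R => x + t *: v).
Proof.
move=> t; apply: (@continuous_comp R (R * X)%type X
  (fun t => (t, v)) (fun z => x + z.1 *: z.2)).
  by apply: (@cvg_pair _ _ _ _ (nbhs t)); [exact: cvg_id|exact: cvg_cst].
exact: translate_scale_continuous.
Qed.

Lemma homothety_continuous (x : X) (c : R) : continuous (fun v : X => x + c *: v).
Proof.
move=> v; apply: (@continuous_comp X (R * X)%type X
  (fun v => (c, v)) (fun z => x + z.1 *: z.2)).
  by apply: (@cvg_pair _ _ _ _ (nbhs c)); [exact: cvg_cst|exact: cvg_id].
exact: translate_scale_continuous.
Qed.

Lemma translation_continuous (v : X) : continuous (fun x : X => x + v).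
Proof.
move=> y; apply: (@continuous_comp X (X * X)%type X
   (fun x => (x, v)) (fun z => z.1 + z.2)); last exact: add_continuous.
by apply: (@cvg_pair _ _ _ _ (nbhs y)); [exact: cvg_id|exact: cvg_cst].
Qed.

Lemma homothety_meager (x : X) (c : R) (A : set X) : c != 0 ->
  meager A -> meager [set v | A (x + c *: v)].
Proof.
move=> c0; apply: (preimage_meager _ (fun y => (- c^-1 *: x) + c^-1 *: y)).
- exact: homothety_continuous.
- exact: homothety_continuous.
- by move=> v; rewrite scalerDr scalerA mulVf// scale1r addrA scaleNr addNr add0r.
- move=> y; rewrite scalerDr !scalerA divff// scale1r mulrN divff// scaleN1r.
  by rewrite addrA subrr add0r.
Qed.

(* E x v for x in A *)

Hypothesis baireX : baire_space X.

(** Otherwise [a + v / n] would fall, for each [v] in [O] and all large [n], into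
the meager set [V `\` G], making the open set [O] meager. *)
Lemma quasi_open_meets (V G O E : set X) (a : X) :
  open O -> O !=set0 -> meager (V `\` G) ->
  (forall v, O v -> exists2 e : R, 0 < e &
     forall t : R, 0 < t < e -> V (a + t *: v) /\ E (a + t *: v)) ->
  E `&` G !=set0.
Proof.
move=> oO neO mVG OVE; apply: contrapT => /set0P/negP/negPn/eqP EG.
suff /(baire_open_meager O baireX oO) OE : meager O by case: neO => x; rewrite OE.
apply: (@sub_meager _ _
  (\bigcup_n [set v | (V `\` G) (a + n.+1%:R^-1 *: v)])); last first.
  by apply: bigcup_meager => n; exact: homothety_meager.
move=> v /OVE[e e0 VE].
have [n ne] := natSinv_lt _ e0.
have ne0 : 0 < (n.+1%:R^-1 : R) < e by rewrite ne invr_gt0 ltr0n.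
have [Vv Ev] := VE _ ne0.
exists n => //; split => // Gv.
by have : (E `&` G) (a + n.+1%:R^-1 *: v) by []; rewrite EG.
Qed.

(** An l-open set is in the closure of every open set equal to it modulo meager
sets. *)
Lemma l_open_meets_quasi_open (V G E : set X) :
  meager (V `\` G) -> l_neighborhood V V -> open E ->
  E `&` V !=set0 -> E `&` G !=set0.
Proof.
move=> mVG lV oE [a [Ea Va]]; apply: (quasi_open_meets V G setT) => //.
- exact: openT.
- by exists a.
move=> v _; have [e e0 eV] := lV _ v Va.
have [d /= d0 dE] : nbhs (0 : R) [set t | E (a + t *: v)].
  apply: (line_continuous a v 0); apply: open_nbhs_nbhs; split => //.
  by rewrite scale0r addr0.
exists (Num.min d e); first by rewrite lt_min d0.
move=> t /andP[t0]; rewrite lt_min => /andP[td te]; split.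
  by apply: eV; rewrite ltW.
by apply: dE; rewrite /ball /= sub0r normrN gtr0_norm.
Qed.

Lemma separating_quasi_open (V W : set X) : Baire_property W ->
  Baire_property V -> l_neighborhood V V -> V `&` W = set0 ->
  exists G, [/\ open G, meager (W `\` G) & G `&` closure V = set0].
Proof.
move=> [G oG mG] [H oH mH] lV VW; exists G; split => //.
  by apply: sub_meager mG; right.
have GH : G `&` H = set0.
  apply: baire_open_meager => //; first exact: openI.
  apply: sub_meager (setU_meager _ _ mG mH) => x [Gx Hx].
  have [Vx|nVx] := pselect (V x); last by right; left.
  left; left; split => // Wx.
  by have : (V `&` W) x by []; rewrite VW.
apply/seteqP; split => // x [Gx clVx].
have [y [Vy Gy]] : V `&` G !=set0 by apply: clVx; exact: open_nbhs_nbhs.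
have [z Hz] : G `&` H !=set0.
  apply: (l_open_meets_quasi_open V) => //; first by apply: sub_meager mH; right.
  by exists y.
by move: Hz; rewrite GH.
Qed.

Lemma sub_closure_setC_closure (V W : set X) :
  Baire_property W -> l_neighborhood W W ->
  Baire_property V -> l_neighborhood V V -> V `&` W = set0 ->
  W `<=` closure (~` closure V).
Proof.
move=> bW lW bV lV VW; have [G [oG mG GV]] := separating_quasi_open _ _ bW bV lV VW.
move=> x Wx B; rewrite nbhsE => -[C [oC Cx] CB].
have [y [Cy Gy]] : C `&` G !=set0.
  by apply: (l_open_meets_quasi_open W) => //; exists x.
exists y; split; last exact: CB.
by move=> Vy; have : (G `&` closure V) y by []; rewrite GV.
Qed.

(** Were [x] in [W], the open set [G] equal to [W] modulo meager sets would meet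
the cone, which lies in a closed set that [G] misses. *)
Lemma cone_in_closure_notin (V W O : set X) (e : R) (x : X) :
  Baire_property W -> l_neighborhood W W ->
  Baire_property V -> l_neighborhood V V -> V `&` W = set0 ->
  open O -> O !=set0 -> 0 < e ->
  (forall (t : R) v, 0 < t < e -> O v -> closure V (x + t *: v)) -> ~ W x.
Proof.
move=> bW lW bV lV VW oO neO e0 xOV Wx.
have [G [oG mG GV]] := separating_quasi_open _ _ bW bV lV VW.
have [y [Vy Gy]] : closure V `&` G !=set0.
  apply: (quasi_open_meets W G O) => // v Ov.
  have [d d0 dW] := lW _ v Wx.
  exists (Num.min d e); first by rewrite lt_min d0.
  move=> t /andP[t0]; rewrite lt_min => /andP[td te]; split.
    by apply: dW; rewrite ltW.
  by apply: xOV => //; rewrite t0.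
by have : (G `&` closure V) y by []; rewrite GV.
Qed.

End topological_module.

(** * Discontinuities of a linearly continuous function *)

Lemma discontinuity_in_metric {R : realType} {X Y : topologicalType}
    (d : Y -> Y -> R) (f : X -> Y) (x : X) :
  (forall y, nbhs y = nbhs_ball_ (fun p e => [set q | d p q < e]) y) ->
  discontinuity_set f x <->
  exists2 e : R, 0 < e & closure [set z | e <= d (f x) (f z)] x.
Proof.
move=> dN; split=> [nc|[e e0 clx] cf].
  apply: contrapT => ne; apply: nc => B; rewrite /= dN => -[e /= e0 eB].
  apply: contrapT => nB; apply: ne; exists e => // C Cx; apply: contrapT => nC.
  apply: nB; apply: filterS Cx => z Cz; apply: eB => /=; rewrite ltNge.
  by apply/negP => ez; apply: nC; exists z.
have : nbhs (f x) [set q | d (f x) q < e] by rewrite dN; exists e.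
by move=> /cf/clx[z [/= ez]] /=; rewrite ltNge ez.
Qed.

Lemma linearly_continuous_l_neighborhood {R : realType}
    {X : topologicalLmodType R} {Y : topologicalType} (f : X -> Y) (U : set Y) :
  linearly_continuous f -> open U -> l_neighborhood (f @^-1` U) (f @^-1` U).
Proof.
move=> lf oU a v Ua.
have [e /= e0 eU] : nbhs (0 : R) [set t | U (f (a + t *: v))].
  apply: (lf a v 0); apply: open_nbhs_nbhs; split=> //.
  by rewrite scale0r addr0.
exists e => // t /andP[t0 te]; apply: eU.
by rewrite /ball /= sub0r normrN ger0_norm.
Qed.

(** For every [v], [f] maps a segment from [x] in the direction [v] into [U].
The lengths of these segments being bounded below by countably many constants,
by category one bound holds for a set [T n] of directions that is dense in some
open set [B].  By category again some [N j] inside [B] has closure with nonempty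
interior, and by density the segments in all the directions of this interior
stay in the closure of [f @^-1` U]. *)
Lemma linearly_continuous_cone {R : realType} {X : topologicalLmodType R}
    {Y : topologicalType} {J : countType} (f : X -> Y) (U : set Y)
    (N : J -> set X) (x : X) :
  baire_space X -> linearly_continuous f -> open U -> U (f x) ->
  (forall B z, open B -> B z -> exists j, N j z /\ N j `<=` B) ->
  exists (j : J) (n : nat), interior (closure (N j)) !=set0 /\
    forall (t : R) v, 0 < t < n.+1%:R^-1 -> interior (closure (N j)) v ->
      closure (f @^-1` U) (x + t *: v).
Proof.
move=> bX lf oU Ux netN.
pose T n := [set v | forall t : R, 0 < t < n.+1%:R^-1 -> U (f (x + t *: v))].
have TX v : exists n, T n v.
  have [e e0 eU] := linearly_continuous_l_neighborhood f U lf oU x v Ux.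
  have [n ne] := natSinv_lt _ e0.
  exists n => t /andP[t0 tn]; apply: eU; rewrite ltW//=; exact: lt_trans ne.
have [n clT] : exists n, interior (closure (T n)) !=set0.
  apply: contrapT => nT.
  have : [set: X] = set0.
    apply: baire_open_meager => //; first exact: openT.
    exists T; last by apply/seteqP; split=> // v _; have [n] := TX v; exists n.
    by move=> n; apply: contrapT => /eqP/set0P Tn; apply: nT; exists n.
  by move=> X0; have : [set: X] x by []; rewrite X0.
set B := interior (closure (T n)) in clT.
have oB : open B by exact: open_interior.
have [j [NB Nj0]] : exists j, N j `<=` B /\ interior (closure (N j)) !=set0.
  apply: contrapT => nj.
  suff : B = set0 by apply/eqP/set0P.
  apply: baire_open_meager => //.
  have [||G ndG BG] := @bigcup_countType X J nowhere_dense
      (fun j => if `[< N j `<=` B >] then N j else set0).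
  - by rewrite /nowhere_dense closure0 interior0.
  - move=> j; case: asboolP => [NB|_]; last first.
      by rewrite /nowhere_dense closure0 interior0.
    by apply: contrapT => /eqP/set0P Nj; apply: nj; exists j.
  exists G => //; rewrite -BG; apply/seteqP; split=> [z Bz|z [j _]].
    have [j [Njz NB]] := netN B z oB Bz.
    by exists j => //; rewrite asboolT.
  by case: asboolP => // NB; exact: NB.
exists j, n; split=> // t v tn Nv.
have clTv : closure (T n) v.
  move/interior_subset: Nv; apply: closure_sub_closed; first exact: closed_closure.
  exact: subset_trans NB (@interior_subset _ _).
move=> C /(homothety_continuous x t v)/clTv[w [Tw Cw]].
by exists (x + t *: w); split=> //; exact: Tw.
Qed.

(** In the index [(m, k, j, n)], [(m, k)] encodes a ball of [Y] of radius
[1 / (m + 1)] and [(j, n)] the directions and the length of a cone. *)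
Lemma baire_cosmic_sigma_l_miserable {R : realType} {X : topologicalLmodType R}
    {Y : topologicalType} (f : X -> Y) :
  cosmic R X -> baire_space X -> metrizable R Y -> separable_space Y ->
  BP_measurable R f -> linearly_continuous f ->
  sigma_l_miserable (discontinuity_set f).
Proof.
move=> cX bX [d [dxx _ dC dT dN]] [S cS dS] bf lf.
have [N netN] := cosmic_countable_network (0 : X) cX.
have [e Se] := countable_enum S (f 0) cS.
pose rad m : R := m.+1%:R^-1.
have rad_gt0 m : 0 < rad m by rewrite invr_gt0 ltr0n.
pose ball y r := [set q | d y q < r].
have oball y r : open (ball y r).
  apply: functionally_open_open.
  exact: (metric_lt_functionally_open dC dT dN y r).
have bball y r : Baire_property (f @^-1` ball y r).
  exact/bf/(metric_lt_functionally_open dC dT dN).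
pose out y r := [set q | r < d y q].
have oout y r : open (out y r).
  apply: functionally_open_open.
  exact: (metric_gt_functionally_open dC dT dN y r).
have bout y r : Baire_property (f @^-1` out y r).
  exact/bf/(metric_gt_functionally_open dC dT dN).
have lbd := linearly_continuous_l_neighborhood f _ lf.
have ball_out y r : f @^-1` ball y r `&` f @^-1` out y r = set0.
  apply/seteqP; split=> // x []; rewrite /ball /out /= => xr.
  by rewrite ltNge (ltW xr).
pose O j := interior (closure (N j)).
pose F (i : nat * nat * (nat * nat) * nat) :=
  let: (m, k, j, n) := i in let y := e k in let r := rad m in
  [set x | [/\ O j !=set0,
    forall (t : R) v, 0 < t < n.+1%:R^-1 -> O j v ->
      closure (f @^-1` ball y r) (x + t *: v) &
    closure (~` f @^-1` ball y (3 * r)) x]].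
have F_near m k j n x : F (m, k, j, n) x -> d (e k) (f x) <= rad m.
  case=> neO cone _; rewrite leNgt; apply/negP.
  apply: (@cone_in_closure_notin _ _ bX _ _ _ _ x (bout _ _) (lbd _ (oout _ _))
    (bball (e k) _) (lbd _ (oball _ _)) (ball_out _ (rad m)) (open_interior _)
    neO _ cone); rewrite ?invr_gt0 ?ltr0n //.

have [||G GP FG] := @bigcup_countType X _ (fun A => closed A /\ l_miserable A) F.
- split; first exact: closed0.
  exists set0; split; [exact: closed0| |]; by move=> a.
- case=> -[[m k] j] n; split.
    (* each of the three conditions defining [F] is closed *)
    move=> x clx; split.
    + by have [y [[neO _ _] _]] := clx setT filterT.
    + move=> t v tn Ov.
      suff /(_ x clx) : closure (F (m, k, j, n)) `<=`
        (fun z => z + t *: v) @^-1` closure (f @^-1` ball (e k) (rad m)) by [].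
      apply: closure_sub_closed.
        apply: closed_comp; last exact: closed_closure.
        by move=> z _; exact: translation_continuous.
      by move=> z [_ cone _]; exact: cone.
    + by apply: closure_sub_closed clx; [exact: closed_closure|move=> z []].
  exists (closure (f @^-1` ball (e k) (2 * rad m))); split.
  + exact: closed_closure.
  + move=> x v Fx.
    have [|c c0 cV] := lbd _ (oball (e k) (2 * rad m)) x v.
      have := F_near _ _ _ _ _ Fx; have := rad_gt0 m.
      rewrite /= /ball /=; lra.
    by exists c => // t tc; apply: subset_closure; exact: cV.
  + move=> x [_ _ clx].
    have: closure (f @^-1` out (e k) (2 * rad m)) x.
      apply: closure_subset clx => z /=; rewrite /ball /out /=.
      have := rad_gt0 m.
      move=> ? /negP; lra.
    move=> /(closure_subset (sub_closure_setC_closure bX _ _ (bout _ _)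
      (lbd _ (oout _ _)) (bball _ _) (lbd _ (oball _ _)) (ball_out _ _))).
    by apply: closure_sub_closed => //; exact: closed_closure.
exists G => //; rewrite -FG; apply/seteqP; split=> x; last first.
  move=> [[[[m k] j] n] _ Fx]; have fx := F_near _ _ _ _ _ Fx.
  have r0 := rad_gt0 m.
  case: Fx => _ _ clx; apply/(discontinuity_in_metric d f x dN).
  exists (rad m) => //; apply: closure_subset clx => z /= /negP.
  rewrite /ball /=; have := dT (f x) (e k) (f z); lra.
move=> /(discontinuity_in_metric d f x dN)[c c0 clx].
have c40 : 0 < c / 4 by lra.
have [m mc] := natSinv_lt _ c40; rewrite -/(rad m) in mc.
have r0 := rad_gt0 m.
have [k ek] := dense_seq_close dC dN e S (f x) _ dS Se r0.
have [j [n [neO cone]]] := linearly_continuous_cone f _ N x bX lf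
  (oball (e k) (rad m)) ek netN.
exists (m, k, j, n) => //; split=> //.
apply: closure_subset clx => z /= cz; rewrite /ball /=.
by have := dT (e k) (f x) (f z); rewrite (dC (f x) (e k)); apply/contraTnot; lra.
Qed.

(** * Lower semicontinuous functions and weighted sums *)

Section lower_semicontinuity_at.
Context {R : realType} {T : topologicalType}.
Implicit Types (f g : T -> R) (x : T).

Definition lower_semicontinuous_point f x :=
  forall a, a < f x -> \forall y \near x, a < f y.

Lemma real_lower_semicontinuousP f :
  real_lower_semicontinuous f <-> forall x, lower_semicontinuous_point f x.
Proof.
split=> [lf x a ax|lf a]; first by apply: open_nbhs_nbhs; split => //; exact: lf.
by rewrite openE => x; exact: lf.
Qed.

Lemma continuous_lower_semicontinuous_point f x :
  {for x, continuous f} -> lower_semicontinuous_point f x.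
Proof. by move=> cf a ax; exact: cvgr_gt cf _ ax. Qed.

Lemma lower_semicontinuous_pointD f g x :
  lower_semicontinuous_point f x -> lower_semicontinuous_point g x ->
  lower_semicontinuous_point (fun y => f y + g y) x.
Proof.
move=> lf lg a ax; pose e := (f x + g x - a) / 2.
have e0 : 0 < e by rewrite /e; lra.
have fx : f x - e < f x by lra.
have gx : g x - e < g x by lra.
apply: filterS2 (lf _ fx) (lg _ gx) => y.
by rewrite /e; lra.
Qed.

Lemma lower_semicontinuous_point_sum (f : nat -> T -> R) x n :
  (forall k, lower_semicontinuous_point (f k) x) ->
  lower_semicontinuous_point (fun y => \sum_(0 <= k < n) f k y) x.
Proof.
move=> lf; elim: n => [|n IH].
  by move=> a; rewrite big_geq// => a0; apply: nearW => y; rewrite big_geq.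
have := lower_semicontinuous_pointD _ _ _ IH (lf n).
move=> lD a; rewrite big_nat_recr//= => /lD; apply: filterS => y.
by rewrite big_nat_recr.
Qed.

Lemma continuous_of_lower_semicontinuous_point f x :
  lower_semicontinuous_point f x -> lower_semicontinuous_point (fun y => 1 - f y) x ->
  {for x, continuous f}.
Proof.
move=> lf lNf; apply/cvgrPdist_lt => e e0.
have fx : f x - e < f x by lra.
have Nfx : 1 - f x - e < 1 - f x by lra.
apply: filterS2 (lf _ fx) (lNf _ Nfx) => y fy Nfy.
by rewrite ltr_norml; lra.
Qed.

End lower_semicontinuity_at.

Section halving_sum.
Context {R : realType}.
Implicit Types (u v : R^nat).

Definition halving (u : R^nat) : R^nat := fun n => u n / (2 ^ (n + 1))%:R.

Definition halving_sum (u : R^nat) : R := limn (series (halving u)).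

Let weight_gt0 n : 0 < ((2 ^ (n + 1))%:R : R)^-1.
Proof. by rewrite invr_gt0 ltr0n expn_gt0. Qed.

Lemma halving1_cvg : series (halving (fun=> 1)) @ \oo --> (1 : R).
Proof. by have := @cvg_geometric_series_half R 1 0; rewrite expr0 divr1. Qed.

Lemma is_cvg_halving u : (forall n, 0 <= u n <= 1) -> cvgn (series (halving u)).
Proof.
move=> u01; apply: (series_le_cvg (v_ := halving (fun=> 1))) => [n|n|n|].
- by rewrite mulr_ge0 ?(ltW (weight_gt0 _))//; case/andP: (u01 n).
- by rewrite mulr_ge0 ?(ltW (weight_gt0 _)).
- by rewrite ler_wpM2r ?(ltW (weight_gt0 _))//; case/andP: (u01 n).
- by apply/cvg_ex; exists 1; exact: halving1_cvg.
Qed.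

Lemma halving_partial_le u n : (forall n, 0 <= u n <= 1) ->
  \sum_(0 <= k < n) halving u k <= halving_sum u.
Proof.
move=> u01; apply: nondecreasing_cvgn_le; last exact: is_cvg_halving.
apply/nondecreasing_seqP => m; rewrite /series /= big_nat_recr//= lerDl.
by rewrite mulr_ge0 ?(ltW (weight_gt0 _))//; case/andP: (u01 m).
Qed.

Lemma halving_sumC u : (forall n, 0 <= u n <= 1) ->
  halving_sum (fun n => 1 - u n) = 1 - halving_sum u.
Proof.
move=> u01.
have h1 : halving_sum (fun=> 1) = 1 by apply/cvg_lim => //; exact: halving1_cvg.
rewrite -[X in _ = X - _]h1 -lim_seriesB; last 2 first.
- by apply: is_cvg_halving => _; rewrite ler01 lexx.
- exact: is_cvg_halving.
congr (limn (series _)); apply/funext => n.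
by rewrite /halving/= mulrBl.
Qed.

Lemma halving_sum01 u : (forall n, 0 <= u n <= 1) -> 0 <= halving_sum u <= 1.
Proof.
move=> u01; have v01 n : 0 <= 1 - u n <= 1 by have := u01 n; lra.
have := halving_partial_le u 0 u01; have := halving_partial_le _ 0 v01.
by rewrite halving_sumC// !big_geq//; lra.
Qed.

(** Zeroing the [n]-th term costs [halving u n], so this bounds
the sum from below at points where the [n]-th function jumps up. *)
Lemma halving_sum_drop u n : (forall n, 0 <= u n <= 1) ->
  halving_sum (fun k => if k == n then 0 else u k) + halving u n <= halving_sum u.
Proof.
move=> u01.
have v01 k : 0 <= (if k == n then 0 else u k) <= 1.
  by case: ifP => // _; rewrite lexx ler01.
rewrite -lerBrDr; apply: limr_le; first exact: is_cvg_halving.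
exists n.+1 => // m /= nm; rewrite lerBrDr.
apply: le_trans (halving_partial_le u m u01).
rewrite /series /= (bigD1_seq n) ?mem_index_iota ?iota_uniq//=.
rewrite [leRHS](bigD1_seq n) ?mem_index_iota ?iota_uniq//=.
rewrite [X in X + _ + _](_ : _ = 0) ?add0r; last by rewrite /halving eqxx mul0r.
rewrite [leRHS]addrC lerD2r.
by apply: ler_sum => k /negPf kn; rewrite /halving kn.
Qed.

(** Values of the sum are suprema of its partial sums. *)
Lemma halving_sum_lower_semicontinuous_point {T : topologicalType}
    (f : nat -> T -> R) x :
  (forall n y, 0 <= f n y <= 1) ->
  (forall n, lower_semicontinuous_point (f n) x) ->
  lower_semicontinuous_point (fun y => halving_sum (f ^~ y)) x.
Proof.
move=> f01 lf a ax.
have [m am] : exists m, a < \sum_(0 <= k < m) halving (f ^~ x) k.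
  have [m _ mP] := cvgr_gt _ (is_cvg_halving _ (f01 ^~ x)) _ ax.
  by exists m; exact: mP (leqnn m).
have lw k : lower_semicontinuous_point (fun y => halving (f ^~ y) k) x.
  move=> b; rewrite /halving -ltr_pdivrMr// => /lf.
  by apply: filterS => y; rewrite ltr_pdivrMr.
apply: filterS (lower_semicontinuous_point_sum _ _ m lw a am) => y ay.
by apply: lt_le_trans ay _; exact: halving_partial_le.
Qed.

(** Upper semicontinuity of the sum is the lower semicontinuity of the sum of the
functions [1 - f n]. *)
Lemma halving_sum_continuous {T : topologicalType} (f : nat -> T -> R) x :
  (forall n y, 0 <= f n y <= 1) ->
  (forall n, {for x, continuous (f n)}) ->
  {for x, continuous (fun y => halving_sum (f ^~ y))}.
Proof.
move=> f01 cf; apply: continuous_of_lower_semicontinuous_point.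
  apply: halving_sum_lower_semicontinuous_point => // n.
  exact: continuous_lower_semicontinuous_point.
have -> : (fun y => 1 - halving_sum (f ^~ y)) =
    (fun y => halving_sum (fun n => 1 - f n y)).
  by apply/funext => y; rewrite halving_sumC.
apply: (halving_sum_lower_semicontinuous_point (fun n y => 1 - f n y)).
  by move=> n y; have := f01 n y; lra.
move=> n; apply: continuous_lower_semicontinuous_point.
by apply: cvgB; [exact: cvg_cst|exact: cf].
Qed.

(** Near [x] the sum [halving_sum (g ^~ y)] without the [n]-th term is almost at
least its value at [x], so at the points [y] where [f n y = 1] the whole sum
exceeds its value at [x] by [c / 2], where [c = 2 ^ -(n + 1)]. *)
Lemma halving_sum_discontinuous {T : topologicalType} (f : nat -> T -> R) n x :
  (forall n y, 0 <= f n y <= 1) ->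
  (forall n, lower_semicontinuous_point (f n) x) ->
  f n x = 0 -> closure [set y | f n y = 1] x ->
  discontinuity_set (fun y => halving_sum (f ^~ y)) x.
Proof.
move=> f01 lf fnx0 clx cS.
pose g k y := if k == n then 0 else f k y.
have g01 k y : 0 <= g k y <= 1.
  by rewrite /g; case: ifP => // _; rewrite lexx ler01.
have lg k : lower_semicontinuous_point (g k) x.
  rewrite /g; case: eqP => _; last exact: lf.
  by apply: continuous_lower_semicontinuous_point; exact: cst_continuous.
pose c : R := ((2 ^ (n + 1))%:R)^-1.
have c0 : 0 < c by exact: weight_gt0.
have gx : halving_sum (g ^~ x) = halving_sum (f ^~ x).
  congr halving_sum; apply/funext => k; rewrite /g; case: eqP => // ->.
  by rewrite fnx0.
have lt1 : halving_sum (f ^~ x) - c / 2 < halving_sum (g ^~ x) by rewrite gx; lra.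
have lt2 : halving_sum (f ^~ x) < halving_sum (f ^~ x) + c / 2 by lra.
have near1 := halving_sum_lower_semicontinuous_point _ _ g01 lg _ lt1.
have near2 := cvgr_lt (FF := nbhs_filter x) _ cS _ lt2.
have [y [/= fny1 [/= gy fy]]] := clx _ (filterI near1 near2).
have : halving_sum (g ^~ y) + c <= halving_sum (f ^~ y).
  by have := halving_sum_drop (f ^~ y) n (f01 ^~ y); rewrite /halving fny1 mul1r.
by lra.
Qed.

End halving_sum.

(** * Functions with prescribed discontinuities *)

(** An l-neighborhood is one-sided along each direction; applying this to [v] and
to [- v] covers a neighborhood of the parameter. *)
Lemma l_neighborhood_near {R : realType} {X : topologicalLmodType R}
    (L F : set X) (x v : X) (t : R) :
  l_neighborhood L F -> F (x + t *: v) -> \forall s \near t, L (x + s *: v).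
Proof.
move=> lL Fp.
have [e e0 eL] := lL _ v Fp; have [c c0 cL] := lL _ (- v) Fp.
exists (Num.min e c); first by rewrite /= lt_min e0.
move=> s /=; rewrite lt_min => /andP[se sc].
have [ts|st] := leP t s.
  have := eL (s - t); rewrite -addrA -scalerDl subrKC; apply.
  by rewrite subr_ge0 ts/=; rewrite distrC ger0_norm ?subr_ge0 in se.
have := cL (t - s).
rewrite scalerN -scaleNr -addrA -scalerDl opprB subrKC; apply.
by rewrite subr_ge0 (ltW st)/=; rewrite ger0_norm ?subr_ge0 ?(ltW st) in sc.
Qed.

Lemma l_miserable_bump {R : realType} {X : topologicalLmodType R} (F : set X) :
  metrizable R X -> closed F -> l_miserable F ->
  exists g : X -> R, [/\ forall x, 0 <= g x <= 1,
    forall x, ~ F x -> {for x, continuous g},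
    forall x, F x -> g x = 0 /\ closure [set y | g y = 1] x &
    linearly_continuous g].
Proof.
move=> [d [dxx d0 dC dT dN]] cF [L [cL lL FL]].
have sFL : F `<=` L.
  move=> x Fx; have [e e0 /(_ 0)] := lL x 0 Fx.
  by rewrite scaler0 addr0; apply; rewrite lexx.
have [g [g01 cg gL gF]] := discontinuous_bump dxx d0 dC dT dN F L cF cL sFL FL.
exists g; split=> //.
  by move=> x Fx; split; [apply: gL; exact: sFL|exact: gF].
move=> x v t; have [Fp|nFp] := pselect (F (x + t *: v)); last first.
  by apply: continuous_comp; [exact: line_continuous|exact: cg].
rewrite /continuous_at gL; last exact: sFL.
apply: cvg_near_cst; apply: filterS (l_neighborhood_near L F x v t lL Fp) => s.
by move=> /gL ->.
Qed.

Lemma sigma_l_miserable_discontinuity_set {R : realType}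
    {X : topologicalLmodType R} (M : set X) :
  metrizable R X -> sigma_l_miserable M ->
  exists f : X -> R,
    [/\ forall x, 0 <= f x <= 1, real_lower_semicontinuous f,
        linearly_continuous f & discontinuity_set f = M].
Proof.
move=> mX [F FP ->].
have /choice[g gP] n := l_miserable_bump (F n) mX (FP n).1 (FP n).2.
have g01 n x : 0 <= g n x <= 1 by have [+ _ _ _] := gP n; apply.
have cg n x : ~ F n x -> {for x, continuous (g n)} by have [_ + _ _] := gP n; apply.
have gF n x : F n x -> g n x = 0 /\ closure [set y | g n y = 1] x.
  by have [_ _ + _] := gP n; apply.
have lcg n : linearly_continuous (g n) by have [] := gP n.
have lg n x : lower_semicontinuous_point (g n) x.
  have [Fx|nFx] := pselect (F n x); last first.
    exact/continuous_lower_semicontinuous_point/cg.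
  move=> a; rewrite (gF n x Fx).1 => a0; apply: nearW => y.
  by apply: lt_le_trans a0 _; case/andP: (g01 n y).
exists (fun x => halving_sum (g ^~ x)); split.
- by move=> x; exact: halving_sum01.
- by apply/real_lower_semicontinuousP => x; exact: halving_sum_lower_semicontinuous_point.
- move=> x v t.
  have := halving_sum_continuous (fun n (s : R) => g n (x + s *: v)) t.
  by apply=> // n; exact: lcg.
apply/seteqP; split=> x; last first.
  by move=> [n _ Fx]; apply: (halving_sum_discontinuous g n) => //; have [] := gF n x Fx.
move=> Dx; apply: contrapT => nFx; apply: Dx.
by apply: halving_sum_continuous => // n; apply: cg => Fx; apply: nFx; exists n.
Qed.

Theorem theorem1p5 (R : realType) :
  (forall (X : topologicalLmodType R) (Y : topologicalType) (f : X -> Y),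
     hausdorff_space X -> cosmic R X -> baire_space X ->
     metrizable R Y -> separable_space Y ->
     BP_measurable R f -> linearly_continuous f ->
     sigma_l_miserable (discontinuity_set f))
  /\
  (forall (X : topologicalLmodType R) (M : set X),
     hausdorff_space X -> metrizable R X ->
     sigma_l_miserable M ->
     exists f : X -> R,
       [/\ forall x, 0 <= f x <= 1,
           real_lower_semicontinuous f,
           Fsigma_measurable R f,
           linearly_continuous f &
           discontinuity_set f = M]).
Proof.
split=> [X Y f _|X M _ mX /(sigma_l_miserable_discontinuity_set _ mX)].
  exact: baire_cosmic_sigma_l_miserable.
move=> [f [f01 lf lcf DfM]]; exists f; split=> //.
have [d [dxx _ dC dT dN]] := mX.
exact: (lower_semicontinuous_Fsigma_measurable dxx dC dT dN).
Qed.
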